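(* Let $E=D[x,y;\sigma,\tau,b,\rho]$ be a diskew polynomial ring such that $\rho$ is a unit, let $\mathcal{D}=D[h;\nu=\tau\sigma]$ and $C=h+\alpha$ where $h=yx$ and $\alpha\in D$. The following statements are equivalent. 1. The element $C$ is left normal in $E$. 2. $\rho\alpha-\sigma(\alpha)=b$, $\nu(\alpha)=\alpha$ and $\alpha d=\nu(d)\alpha$ for all elements $d\in D$. If one of the equivalent conditions holds then $[h,C]=0$ and (a) $C=\rho^{-1}(xy+\sigma(\alpha))$, $xC=\rho Cx$ and $yC=\tau(\rho^{-1})Cy$. (b) $E\simeq D[C;\nu][x,y;\sigma,\tau,a:=C-\alpha]$ is a generalized Weyl algebra where $\sigma(C)=\rho C$ and $\tau(C)=\tau(\rho^{-1})C$. (c) The element $C$ is a left normal, left regular element of $E$ and $E/(C)\simeq D[x,y;\sigma,\tau,-\alpha]$ is a generalized Weyl algebra. (d) The element $C$ is a normal element in $E$ iff $\mathrm{im}(\nu)=D$. (e) The element $C$ is regular iff $C$ is right regular iff $\ker(\nu)=0$. (f) The element $C$ is a normal, regular element iff $\nu$ is an automorphism of $D$.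
   Context: Diskew polynomial ring: let $D$ be a ring, $\sigma,\tau$ ring endomorphisms of $D$, and $\rho,b\in D$ such that $\sigma\tau(d)\rho=\rho\,\tau\sigma(d)$ and $\sigma\tau(d)b=bd$ for all $d\in D$. Then $E=D[x,y;\sigma,\tau,b,\rho]$ is the ring generated by $D$, $x$ and $y$ subject to the defining relations $xd=\sigma(d)x$, $yd=\tau(d)y$ for all $d\in D$, and $xy-\rho yx=b$. Products of endomorphisms are compositions. When $\rho$ is a unit, the subring of $E$ generated by $D$ and $h=yx$ is the skew polynomial ring $D[h;\nu]$ ($hd=\nu(d)h$ for $d\in D$). Generalized Weyl algebra: for a ring $R$, ring endomorphisms $\sigma,\tau$ of $R$ and $a\in R$ with $\tau\sigma(a)=a$, $ar=\tau\sigma(r)a$ and $\sigma(a)r=\sigma\tau(r)\sigma(a)$ for all $r\in R$, $R[x,y;\sigma,\tau,a]$ is the ring generated by $R$, $x$, $y$ subject to $xr=\sigma(r)x$, $yr=\tau(r)y$ for all $r\in R$, $yx=a$, $xy=\sigma(a)$. An element $r$ of a ring $R$ is left normal if $rR\subseteq Rr$, normal if $rR=Rr$; left regular if $r'r=0$ implies $r'=0$; right regular if $rr'=0$ implies $r'=0$; regular if both. $(C)$ is the two-sided ideal generated by $C$; $[s,t]=st-ts$. *)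

(* Defs.v *)
From HB Require Import structures.
From mathcomp Require Import all_boot all_algebra.
From mathcomp Require Import boolp.

Set Implicit Arguments.
Unset Strict Implicit.
Unset Printing Implicit Defensive.

Import GRing.Theory.
Local Open Scope ring_scope.
Local Open Scope quotient_scope.

(* Rings are associative and unital, possibly trivial and possibly not        *)
(* commutative: [pzRingType].  Ring morphisms are unital.                     *)

(* [pres rel] is the ring generated by a ring [R] and a family of letters     *)
(* indexed by [I], subject to the relations [u = v] for [rel u v]: formal     *)
(* ring expressions modulo the least congruence which contains [rel], the     *)
(* ring axioms and the ring operations of [R].  The canonical map             *)
(* [pres_coef rel : R -> pres rel] need not be injective in general.          *)
Inductive rterm (R I : Type) :=
  | Coef of R
  | Gen of I
  | TAdd of rterm R I & rterm R I
  | TOpp of rterm R I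
  | TMul of rterm R I & rterm R I.

Arguments Coef {R I} _.
Arguments Gen {R I} _.

Declare Scope rterm_scope.
Delimit Scope rterm_scope with rterm.
Bind Scope rterm_scope with rterm.
Notation "u + v" := (TAdd u v) : rterm_scope.
Notation "- u" := (TOpp u) : rterm_scope.
Notation "u - v" := (TAdd u (TOpp v)) : rterm_scope.
Notation "u * v" := (TMul u v) : rterm_scope.

HB.instance Definition _ (R I : Type) := gen_eqMixin (rterm R I).
HB.instance Definition _ (R I : Type) := gen_choiceMixin (rterm R I).

Section Presentation.
Variables (R : pzRingType) (I : Type).
Implicit Types u v w : rterm R I.

Inductive pres_eq (rel : rterm R I -> rterm R I -> Prop) :
    rterm R I -> rterm R I -> Prop :=
  | pres_rel u v : rel u v -> pres_eq rel u v
  | pres_refl u : pres_eq rel u u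
  | pres_sym u v : pres_eq rel u v -> pres_eq rel v u
  | pres_trans v u w : pres_eq rel u v -> pres_eq rel v w -> pres_eq rel u w
  | pres_add u u' v v' :
      pres_eq rel u u' -> pres_eq rel v v' -> pres_eq rel (u + v) (u' + v')
  | pres_opp u u' : pres_eq rel u u' -> pres_eq rel (- u) (- u')
  | pres_mul u u' v v' :
      pres_eq rel u u' -> pres_eq rel v v' -> pres_eq rel (u * v) (u' * v')
  | pres_addA u v w : pres_eq rel (u + (v + w)) (u + v + w)
  | pres_addC u v : pres_eq rel (u + v) (v + u)
  | pres_add0 u : pres_eq rel (Coef 0 + u) u
  | pres_addN u : pres_eq rel (- u + u) (Coef 0)
  | pres_mulA u v w : pres_eq rel (u * (v * w)) (u * v * w)
  | pres_mul1l u : pres_eq rel (Coef 1 * u) u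
  | pres_mul1r u : pres_eq rel (u * Coef 1) u
  | pres_mulDl u v w : pres_eq rel ((u + v) * w) (u * w + v * w)
  | pres_mulDr u v w : pres_eq rel (u * (v + w)) (u * v + u * w)
  | pres_coefD r s : pres_eq rel (Coef (r + s)%R) (Coef r + Coef s)
  | pres_coefM r s : pres_eq rel (Coef (r * s)%R) (Coef r * Coef s).

Variable rel : rterm R I -> rterm R I -> Prop.

Definition pres_eqb u v : bool := `[< pres_eq rel u v >].

Lemma pres_eqb_refl : reflexive pres_eqb.
Proof. by move=> u; apply/asboolP/pres_refl. Qed.

Lemma pres_eqb_sym : symmetric pres_eqb.
Proof.
by move=> u v; apply/idP/idP=> /asboolP e; apply/asboolP; exact: pres_sym.
Qed.

Lemma pres_eqb_trans : transitive pres_eqb.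
Proof.
move=> v u w /asboolP uv /asboolP vw; apply/asboolP.
exact: pres_trans uv vw.
Qed.

Canonical pres_equiv := EquivRel pres_eqb pres_eqb_refl pres_eqb_sym
  pres_eqb_trans.

Definition pres := {eq_quot pres_equiv}.

HB.instance Definition _ := Choice.on pres.
HB.instance Definition _ := EqQuotient.on pres.

Definition pres_class u : pres := \pi_pres u.

Lemma pres_classP u v : pres_class u = pres_class v <-> pres_eq rel u v.
Proof.
split=> [/eqquotP/asboolP // | e].
by apply/eqquotP/asboolP.
Qed.

Lemma pres_class_surj (a : pres) : exists u, a = pres_class u.
Proof. by exists (repr a); rewrite /pres_class reprK. Qed.

Definition padd (a b : pres) : pres := pres_class (repr a + repr b)%rterm.
Definition popp (a : pres) : pres := pres_class (- repr a)%rterm.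
Definition pmul (a b : pres) : pres := pres_class (repr a * repr b)%rterm.

Lemma repr_class u : pres_eq rel (repr (pres_class u)) u.
Proof. by apply/pres_classP; rewrite /pres_class reprK. Qed.

Lemma paddE u v : padd (pres_class u) (pres_class v) = pres_class (u + v)%rterm.
Proof. by apply/pres_classP/pres_add; exact: repr_class. Qed.

Lemma poppE u : popp (pres_class u) = pres_class (- u)%rterm.
Proof. by apply/pres_classP/pres_opp/repr_class. Qed.

Lemma pmulE u v : pmul (pres_class u) (pres_class v) = pres_class (u * v)%rterm.
Proof. by apply/pres_classP/pres_mul; exact: repr_class. Qed.

Let E := (paddE, poppE, pmulE).

Fact paddA : associative padd.
Proof.
move=> a b c; have [u ->] := pres_class_surj a; have [v ->] := pres_class_surj b.
have [w ->] := pres_class_surj c; rewrite !E.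
exact/pres_classP/pres_addA.
Qed.

Fact paddC : commutative padd.
Proof.
move=> a b; have [u ->] := pres_class_surj a; have [v ->] := pres_class_surj b.
rewrite !E; exact/pres_classP/pres_addC.
Qed.

Fact padd0 : left_id (pres_class (Coef 0)) padd.
Proof.
by move=> a; have [u ->] := pres_class_surj a; rewrite E; apply/pres_classP/pres_add0.
Qed.

Fact paddN : left_inverse (pres_class (Coef 0)) popp padd.
Proof.
by move=> a; have [u ->] := pres_class_surj a; rewrite !E; apply/pres_classP/pres_addN.
Qed.

Fact pmulA : associative pmul.
Proof.
move=> a b c; have [u ->] := pres_class_surj a; have [v ->] := pres_class_surj b.
have [w ->] := pres_class_surj c; rewrite !E.
exact/pres_classP/pres_mulA.
Qed.

Fact pmul1l : left_id (pres_class (Coef 1)) pmul.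
Proof.
by move=> a; have [u ->] := pres_class_surj a; rewrite E; apply/pres_classP/pres_mul1l.
Qed.

Fact pmul1r : right_id (pres_class (Coef 1)) pmul.
Proof.
by move=> a; have [u ->] := pres_class_surj a; rewrite E; apply/pres_classP/pres_mul1r.
Qed.

Fact pmulDl : left_distributive pmul padd.
Proof.
move=> a b c; have [u ->] := pres_class_surj a; have [v ->] := pres_class_surj b.
have [w ->] := pres_class_surj c; rewrite !E.
exact/pres_classP/pres_mulDl.
Qed.

Fact pmulDr : right_distributive pmul padd.
Proof.
move=> a b c; have [u ->] := pres_class_surj a; have [v ->] := pres_class_surj b.
have [w ->] := pres_class_surj c; rewrite !E.
exact/pres_classP/pres_mulDr.
Qed.

HB.instance Definition _ := GRing.isPzRing.Build pres
  paddA paddC padd0 paddN pmulA pmul1l pmul1r pmulDl pmulDr.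

Definition pres_coef (r : R) : pres := pres_class (Coef r).
Definition pres_gen (i : I) : pres := pres_class (Gen i).

Fact pres_coef_is_zmod : zmod_morphism pres_coef.
Proof.
have cD r s : pres_coef (r + s) = pres_coef r + pres_coef s.
  by rewrite -[RHS]/(padd _ _) paddE; apply/pres_classP/pres_coefD.
by move=> r s; apply/(canRL (addrK _)); rewrite -cD subrK.
Qed.

Fact pres_coef_is_monoid : monoid_morphism pres_coef.
Proof.
split=> // r s.
by rewrite -[RHS]/(pmul _ _) pmulE; apply/pres_classP/pres_coefM.
Qed.

HB.instance Definition _ :=
  GRing.isZmodMorphism.Build R pres pres_coef pres_coef_is_zmod.
HB.instance Definition _ :=
  GRing.isMonoidMorphism.Build R pres pres_coef pres_coef_is_monoid.

End Presentation.

Variant xy_letter := X | Y.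

Section SkewPoly.
Variables (D : pzRingType) (nu : {rmorphism D -> D}).

Variant skew_rel : rterm D unit -> rterm D unit -> Prop :=
  | skew_hd d : skew_rel (Gen tt * Coef d) (Coef (nu d) * Gen tt).

(* The skew polynomial ring D[h; nu], coefficients on the left. *)
Definition skew_poly : pzRingType := pres skew_rel.
Definition skew_coef : {rmorphism D -> skew_poly} := pres_coef skew_rel.
Definition skew_var : skew_poly := pres_gen skew_rel tt.

End SkewPoly.

Section Diskew.
Variables (D : pzRingType) (sigma tau : {rmorphism D -> D}) (b rho : D).

Definition diskew_axiom : Prop :=
  (forall d, sigma (tau d) * rho = rho * tau (sigma d)) /\
  (forall d, sigma (tau d) * b = b * d).

Variant diskew_rel : rterm D xy_letter -> rterm D xy_letter -> Prop :=
  | diskew_xd d : diskew_rel (Gen X * Coef d) (Coef (sigma d) * Gen X)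
  | diskew_yd d : diskew_rel (Gen Y * Coef d) (Coef (tau d) * Gen Y)
  | diskew_xy : diskew_rel (Gen X * Gen Y - Coef rho * Gen Y * Gen X) (Coef b).

(* D[x, y; sigma, tau, b, rho]; meaningful under [diskew_axiom]. *)
Definition diskew : pzRingType := pres diskew_rel.
Definition diskew_coef : {rmorphism D -> diskew} := pres_coef diskew_rel.
Definition diskew_x : diskew := pres_gen diskew_rel X.
Definition diskew_y : diskew := pres_gen diskew_rel Y.

End Diskew.

Section GeneralizedWeylAlgebra.
Variables (R : pzRingType) (sigma tau : {rmorphism R -> R}) (a : R).

Definition gwa_axiom : Prop :=
  [/\ tau (sigma a) = a,
      forall r, a * r = tau (sigma r) * a
    & forall r, sigma a * r = sigma (tau r) * sigma a].

Variant gwa_rel : rterm R xy_letter -> rterm R xy_letter -> Prop :=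
  | gwa_xr r : gwa_rel (Gen X * Coef r) (Coef (sigma r) * Gen X)
  | gwa_yr r : gwa_rel (Gen Y * Coef r) (Coef (tau r) * Gen Y)
  | gwa_yx : gwa_rel (Gen Y * Gen X) (Coef a)
  | gwa_xy : gwa_rel (Gen X * Gen Y) (Coef (sigma a)).

(* R[x, y; sigma, tau, a]; meaningful under [gwa_axiom]. *)
Definition gwa : pzRingType := pres gwa_rel.
Definition gwa_coef : {rmorphism R -> gwa} := pres_coef gwa_rel.
Definition gwa_x : gwa := pres_gen gwa_rel X.
Definition gwa_y : gwa := pres_gen gwa_rel Y.

End GeneralizedWeylAlgebra.

Section Elements.
Variable (S : pzRingType).
Implicit Types r s : S.

Definition left_normal r := forall s, exists s', r * s = s' * r.
Definition normal_elt r :=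
  left_normal r /\ (forall s, exists s', s * r = r * s').

(* Sides as in noncommutative ring theory texts: multiplication by [r] on the *)
(* right is injective.  The library's [GRing.lreg] is the other side.         *)
Definition left_regular r := forall s, s * r = 0 -> s = 0.
Definition right_regular r := forall s, r * s = 0 -> s = 0.
Definition regular_elt r := left_regular r /\ right_regular r.

Definition ring_comm r s := r * s - s * r.

End Elements.

Section IdealQuotient.
Variables (S : pzRingType) (c : S).

(* The two-sided ideal (c); it may be the whole ring. *)
Definition in_ideal (s : S) : Prop :=
  exists e : seq (S * S), s = \sum_(p <- e) p.1 * c * p.2.

Lemma in_ideal0 : in_ideal 0.
Proof. by exists [::]; rewrite big_nil. Qed.

Lemma in_idealD s t : in_ideal s -> in_ideal t -> in_ideal (s + t).
Proof. by move=> [e ->] [e' ->]; exists (e ++ e'); rewrite big_cat. Qed.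

Lemma in_idealMl u s : in_ideal s -> in_ideal (u * s).
Proof.
move=> [e ->]; exists [seq (u * p.1, p.2) | p <- e].
by rewrite big_map mulr_sumr; apply: eq_bigr => p _; rewrite !mulrA.
Qed.

Lemma in_idealMr u s : in_ideal s -> in_ideal (s * u).
Proof.
move=> [e ->]; exists [seq (p.1, p.2 * u) | p <- e].
by rewrite big_map mulr_suml; apply: eq_bigr => p _; rewrite !mulrA.
Qed.

Lemma in_idealN s : in_ideal s -> in_ideal (- s).
Proof. by move=> /(in_idealMl (-1)); rewrite mulN1r. Qed.

Definition ideal_eqb (s t : S) : bool := `[< in_ideal (s - t) >].

Lemma ideal_eqb_refl : reflexive ideal_eqb.
Proof. by move=> s; apply/asboolP; rewrite subrr; exact: in_ideal0. Qed.

Lemma ideal_eqb_sym : symmetric ideal_eqb.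
Proof.
by move=> s t; apply/idP/idP => /asboolP/in_idealN; rewrite opprB => /asboolP.
Qed.

Lemma ideal_eqb_trans : transitive ideal_eqb.
Proof.
move=> t s r /asboolP st /asboolP tr; apply/asboolP.
by have := in_idealD st tr; rewrite addrA subrK.
Qed.

Canonical ideal_equiv := EquivRel ideal_eqb ideal_eqb_refl ideal_eqb_sym
  ideal_eqb_trans.

(* The quotient ring S/(c). *)
Definition quot_ring := {eq_quot ideal_equiv}.

HB.instance Definition _ := Choice.on quot_ring.
HB.instance Definition _ := EqQuotient.on quot_ring.

Definition quot_proj (s : S) : quot_ring := \pi_quot_ring s.

Lemma quot_projP s t : quot_proj s = quot_proj t <-> in_ideal (s - t).
Proof.
split=> [/eqquotP/asboolP // | e].
by apply/eqquotP/asboolP.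
Qed.

Lemma quot_proj_surj (a : quot_ring) : exists s, a = quot_proj s.
Proof. by exists (repr a); rewrite /quot_proj reprK. Qed.

Definition qadd (p q : quot_ring) := quot_proj (repr p + repr q).
Definition qopp (p : quot_ring) := quot_proj (- repr p).
Definition qmul (p q : quot_ring) := quot_proj (repr p * repr q).

Lemma repr_proj s : in_ideal (repr (quot_proj s) - s).
Proof. by apply/quot_projP; rewrite /quot_proj reprK. Qed.

Lemma qaddE s t : qadd (quot_proj s) (quot_proj t) = quot_proj (s + t).
Proof.
apply/quot_projP; rewrite opprD addrACA.
by apply: in_idealD; exact: repr_proj.
Qed.

Lemma qoppE s : qopp (quot_proj s) = quot_proj (- s).
Proof. by apply/quot_projP; rewrite -opprD; apply/in_idealN/repr_proj. Qed.

Lemma qmulE s t : qmul (quot_proj s) (quot_proj t) = quot_proj (s * t).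
Proof.
apply/quot_projP; set s' := repr _; set t' := repr _.
have -> : s' * t' - s * t = (s' - s) * t' + s * (t' - t).
  by rewrite mulrBl mulrBr addrA subrK.
apply: in_idealD; [apply: in_idealMr | apply: in_idealMl]; exact: repr_proj.
Qed.

Let E := (qaddE, qoppE, qmulE).

Fact qaddA : associative qadd.
Proof.
move=> p q r; have [s ->] := quot_proj_surj p; have [t ->] := quot_proj_surj q.
by have [w ->] := quot_proj_surj r; rewrite !E addrA.
Qed.

Fact qaddC : commutative qadd.
Proof.
move=> p q; have [s ->] := quot_proj_surj p; have [t ->] := quot_proj_surj q.
by rewrite !E addrC.
Qed.

Fact qadd0 : left_id (quot_proj 0) qadd.
Proof. by move=> p; have [s ->] := quot_proj_surj p; rewrite E add0r. Qed.

Fact qaddN : left_inverse (quot_proj 0) qopp qadd.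
Proof. by move=> p; have [s ->] := quot_proj_surj p; rewrite !E addNr. Qed.

Fact qmulA : associative qmul.
Proof.
move=> p q r; have [s ->] := quot_proj_surj p; have [t ->] := quot_proj_surj q.
by have [w ->] := quot_proj_surj r; rewrite !E mulrA.
Qed.

Fact qmul1l : left_id (quot_proj 1) qmul.
Proof. by move=> p; have [s ->] := quot_proj_surj p; rewrite E mul1r. Qed.

Fact qmul1r : right_id (quot_proj 1) qmul.
Proof. by move=> p; have [s ->] := quot_proj_surj p; rewrite E mulr1. Qed.

Fact qmulDl : left_distributive qmul qadd.
Proof.
move=> p q r; have [s ->] := quot_proj_surj p; have [t ->] := quot_proj_surj q.
by have [w ->] := quot_proj_surj r; rewrite !E mulrDl.
Qed.

Fact qmulDr : right_distributive qmul qadd.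
Proof.
move=> p q r; have [s ->] := quot_proj_surj p; have [t ->] := quot_proj_surj q.
by have [w ->] := quot_proj_surj r; rewrite !E mulrDr.
Qed.

HB.instance Definition _ := GRing.isPzRing.Build quot_ring
  qaddA qaddC qadd0 qaddN qmulA qmul1l qmul1r qmulDl qmulDr.

Fact quot_proj_is_zmod : zmod_morphism quot_proj.
Proof.
move=> s t; apply/esym; rewrite -[LHS]/(qadd _ (qopp _)).
by rewrite qoppE qaddE.
Qed.

Fact quot_proj_is_monoid : monoid_morphism quot_proj.
Proof. by split=> // s t; apply/esym; rewrite -[LHS]/(qmul _ _) qmulE. Qed.

HB.instance Definition _ :=
  GRing.isZmodMorphism.Build S quot_ring quot_proj quot_proj_is_zmod.
HB.instance Definition _ :=
  GRing.isMonoidMorphism.Build S quot_ring quot_proj quot_proj_is_monoid.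

End IdealQuotient.

(* Main.v *)
Require Import Defs.
From HB Require Import structures.
From mathcomp Require Import all_boot all_algebra.
From mathcomp Require Import boolp functions classical_sets.

Set Implicit Arguments.
Unset Strict Implicit.
Unset Printing Implicit Defensive.

Import GRing.Theory.
Local Open Scope classical_set_scope.
Local Open Scope ring_scope.

(** Why the theorem holds.  Every element of E is uniquely a left D-linear
    combination of the monomials y^i x^j.  They span, because x moves past y^i
    by x y^i = c_i y^i x + e_i y^(i-1) ([diskew_xyX], [diskew_ind]).  They are
    independent, because the same rule defines an action of E on all families
    of elements of D indexed by (i, j): the two identities of [diskew_axiom]
    are what this action needs in order to respect xy - rho yx = b
    ([diskew_act_rel]).  Acting on the family supported at (0, 0) with value 1
    reads off the coefficients of an element ([coef], [coef_monomial]).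

    Multiplying y^i x^j by C = yx + alpha on the right gives a unit times
    y^(i+1) x^(j+1), plus a multiple of y^i x^j ([monomial_mulC]).  Hence s = 0
    as soon as s C has no coefficient at any (i+1, j+1): the coefficients of s
    vanish one after the other down each diagonal ([mulC_diag0]).  In
    particular C is left regular.  The implication 1 => 2 follows too.  Left
    normality writes C t as s C for t = d, x, y in turn.  Subtracting r C, where
    r is nu(d), rho^-1 x or tau(rho) y, removes the leading term and leaves a
    multiple of 1, x or y; so s = r, and that multiple is 0.  These three
    equations are condition 2 ([left_normal_C_cond]).

    Conversely, under condition 2, C moves past d, x and y, with nu acting on
    coefficients and a unit appearing at each monomial; so C s = s' C where the
    coefficients of s' are the nu-images of those of s, times units
    ([C_swap]).  As C is left regular, C is normal exactly when nu is
    surjective ([C_normalP]), and right regular exactly when nu is injective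
    ([C_right_regularP]).

    The two isomorphisms ([diskew_gwa_iso], [quot_C_iso]) need no normal form:
    the rings are given by generators and relations, so mutually inverse
    morphisms are found by checking relations and are compared on generators. *)

(** * Actions and morphisms of presented rings *)

Section PresentationTheory.
Variables (R : pzRingType) (I : Type) (rel : rterm R I -> rterm R I -> Prop).

Lemma pres_classD u v :
  pres_class rel (u + v)%rterm = pres_class rel u + pres_class rel v.
Proof. by rewrite -[RHS]/(padd _ _) paddE. Qed.

Lemma pres_classN u : pres_class rel (- u)%rterm = - pres_class rel u.
Proof. by rewrite -[RHS]/(popp _) poppE. Qed.

Lemma pres_classM u v :
  pres_class rel (u * v)%rterm = pres_class rel u * pres_class rel v.
Proof. by rewrite -[RHS]/(pmul _ _) pmulE. Qed.

Definition pres_classE :=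
  (pres_classD, pres_classN, pres_classM).

Lemma pres_ind (P : pres rel -> Prop) :
    (forall r, P (pres_coef rel r)) -> (forall i, P (pres_gen rel i)) ->
    (forall s t, P s -> P t -> P (s + t)) -> (forall s, P s -> P (- s)) ->
    (forall s t, P s -> P t -> P (s * t)) ->
  forall s, P s.
Proof.
move=> Pc Pg PD PN PM s; have [u ->] := pres_class_surj s.
elim: u => [r|i|u IHu v IHv|u IHu|u IHu v IHv]; rewrite ?pres_classE.
- exact: Pc.
- exact: Pg.
- exact: PD.
- exact: PN.
- exact: PM.
Qed.

Lemma pres_morph_ext (S : pzRingType) (f g : {rmorphism pres rel -> S}) :
    (forall r, f (pres_coef rel r) = g (pres_coef rel r)) ->
    (forall i, f (pres_gen rel i) = g (pres_gen rel i)) ->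
  f =1 g.
Proof.
move=> ec eg; elim/pres_ind=> // [s t|s|s t]; rewrite ?(rmorphD, rmorphN, rmorphM).
- by move=> -> ->.
- by move=> ->.
- by move=> -> ->.
Qed.

Section Action.
Variables (M : zmodType) (sc : R -> M -> M) (gn : I -> M -> M).
Hypotheses (scDr : forall r, {morph sc r : m n / m + n})
           (scDl : forall r s m, sc (r + s) m = sc r m + sc s m)
           (scM : forall r s m, sc (r * s) m = sc r (sc s m))
           (sc1 : forall m, sc 1 m = m)
           (gnD : forall i, {morph gn i : m n / m + n}).

(** A ring generated by [R] and letters acts on an additive group [M] as soon
    as [R] and the letters do and the relations hold for these actions.  Taking
    for [M] a ring on which everything acts by left multiplication gives the
    universal property [pres_lift]; other choices of [M] show that elements of
    the presented ring are distinct. *)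
Fixpoint term_act (u : rterm R I) (m : M) : M :=
  match u with
  | Coef r => sc r m
  | Gen i => gn i m
  | TAdd u v => term_act u m + term_act v m
  | TOpp u => - term_act u m
  | TMul u v => term_act u (term_act v m)
  end.

Hypothesis act_rel : forall u v, rel u v -> term_act u =1 term_act v.

Lemma term_actDr u : {morph term_act u : m n / m + n}.
Proof.
elim: u => [r|i|u IHu v IHv|u IHu|u IHu v IHv] m n //=; first exact: scDr.
- exact: gnD.
- by rewrite IHu IHv addrACA.
- by rewrite IHu opprD.
- by rewrite IHv IHu.
Qed.

Lemma pres_eq_term_act u v : pres_eq rel u v -> term_act u =1 term_act v.
Proof.
have sc0 m : sc 0 m = 0 by apply: (addrI (sc 0 m)); rewrite -scDl !addr0.
elim=> {u v} /= [u v /act_rel //|//|u v _ IH m|v u w _ IH1 _ IH2 m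
  |u u' v v' _ IH1 _ IH2 m|u u' _ IH m|u u' v v' _ IH1 _ IH2 m
  |u v w m|u v m|u m|u m|//|u m|u m|//|u v w m|r s m|r s m] /=.
- by rewrite IH.
- by rewrite IH1.
- by rewrite IH1 IH2.
- by rewrite IH.
- by rewrite IH1 IH2.
- by rewrite addrA.
- by rewrite addrC.
- by rewrite sc0 add0r.
- by rewrite sc0 addNr.
- by rewrite sc1.
- by rewrite sc1.
- by rewrite term_actDr.
- by rewrite scDl.
- by rewrite scM.
Qed.

Definition pres_act (s : pres rel) : M -> M := term_act (repr s).

Lemma pres_act_class u : pres_act (pres_class rel u) =1 term_act u.
Proof. by move=> m; apply/pres_eq_term_act/repr_class. Qed.

Lemma pres_act_coef r m : pres_act (pres_coef rel r) m = sc r m.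
Proof. exact: pres_act_class. Qed.

Lemma pres_act_gen i m : pres_act (pres_gen rel i) m = gn i m.
Proof. exact: pres_act_class. Qed.

Lemma pres_actDl s t m : pres_act (s + t) m = pres_act s m + pres_act t m.
Proof.
have [u ->] := pres_class_surj s; have [v ->] := pres_class_surj t.
by rewrite -pres_classE !pres_act_class.
Qed.

Lemma pres_actM s t m : pres_act (s * t) m = pres_act s (pres_act t m).
Proof.
have [u ->] := pres_class_surj s; have [v ->] := pres_class_surj t.
by rewrite -pres_classE !pres_act_class.
Qed.

End Action.

Section Eval.
Variables (S : pzRingType) (g : {rmorphism R -> S}) (v : I -> S).

Fixpoint term_eval (u : rterm R I) : S :=
  match u with
  | Coef r => g r
  | Gen i => v i
  | TAdd u v => term_eval u + term_eval v
  | TOpp u => - term_eval u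
  | TMul u v => term_eval u * term_eval v
  end.

Lemma pres_lift :
    (forall u w, rel u w -> term_eval u = term_eval w) ->
  exists f : {rmorphism pres rel -> S},
    (forall r, f (pres_coef rel r) = g r) /\
    (forall i, f (pres_gen rel i) = v i).
Proof.
move=> Hrel; pose sc r (m : S) := g r * m; pose gn i (m : S) := v i * m.
have actE u m : term_act sc gn u m = term_eval u * m.
  elim: u m => [r|i|u IHu w IHw|u IHu|u IHu w IHw] m //=.
  - by rewrite IHu IHw mulrDl.
  - by rewrite IHu mulNr.
  - by rewrite IHw IHu mulrA.
pose f (s : pres rel) := term_eval (repr s).
have fE u : f (pres_class rel u) = term_eval u.
  rewrite -[LHS]mulr1 -[RHS]mulr1 -!actE.
  move: (repr_class rel u) (1 : S); apply: pres_eq_term_act.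
  - by move=> r m n; rewrite /sc mulrDr.
  - by move=> r s m; rewrite /sc rmorphD mulrDl.
  - by move=> r s m; rewrite /sc rmorphM mulrA.
  - by move=> m; rewrite /sc rmorph1 mul1r.
  - by move=> i m n; rewrite /gn mulrDr.
  - by move=> u1 u2 /Hrel e m; rewrite !actE e.
have fD : zmod_morphism f.
  move=> s t; have [u ->] := pres_class_surj s; have [w ->] := pres_class_surj t.
  by rewrite -pres_classN -pres_classD !fE.
have fM : monoid_morphism f.
  split=> [|s t]; first by rewrite -[1]/(pres_class rel (Coef 1)) fE /= rmorph1.
  have [u ->] := pres_class_surj s; have [w ->] := pres_class_surj t.
  by rewrite -!pres_classE !fE.
pose fz := GRing.isZmodMorphism.Build _ _ f fD.
pose fm := GRing.isMonoidMorphism.Build _ _ f fM.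
pose F : {rmorphism pres rel -> S} := HB.pack f fz fm.
by exists F; split=> [r|i]; exact: fE.
Qed.

End Eval.

End PresentationTheory.

(** * Units *)

Definition invertible (S : pzRingType) (u : S) :=
  exists v, u * v = 1 /\ v * u = 1.

Section Invertible.
Variable S : pzRingType.
Implicit Types u v : S.

Lemma invertible1 : invertible (1 : S).
Proof. by exists 1; rewrite mulr1. Qed.

Lemma invertibleM u v : invertible u -> invertible v -> invertible (u * v).
Proof.
move=> [u' [uu' u'u]] [v' [vv' v'v]]; exists (v' * u').
by rewrite !mulrA -[u * v * v']mulrA -[v' * u' * u]mulrA vv' u'u !mulr1.
Qed.

Lemma invertible_morph (T : pzRingType) (f : {rmorphism S -> T}) u :
  invertible u -> invertible (f u).
Proof. by move=> [u' [uu' u'u]]; exists (f u'); rewrite -!rmorphM uu' u'u rmorph1. Qed.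

End Invertible.

(** * The normal form basis of a diskew polynomial ring *)

Section DiskewBasis.
Variables (D : pzRingType) (sigma tau : {rmorphism D -> D}) (b rho : D).
Hypothesis hE : diskew_axiom sigma tau b rho.

Local Notation E := (diskew sigma tau b rho).
Local Notation iD := (diskew_coef sigma tau b rho).
Local Notation x := (diskew_x sigma tau b rho).
Local Notation y := (diskew_y sigma tau b rho).

Lemma diskew_xdE d : x * iD d = iD (sigma d) * x.
Proof.
by rewrite -[LHS]pres_classM -[RHS]pres_classM; apply/pres_classP/pres_rel/diskew_xd.
Qed.

Lemma diskew_ydE d : y * iD d = iD (tau d) * y.
Proof.
by rewrite -[LHS]pres_classM -[RHS]pres_classM; apply/pres_classP/pres_rel/diskew_yd.
Qed.

Lemma diskew_yXdE i d : y ^+ i * iD d = iD (iter i tau d) * y ^+ i.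
Proof.
elim: i => [|i IHi]; first by rewrite mul1r mulr1.
by rewrite exprS -mulrA IHi mulrA diskew_ydE /= mulrA.
Qed.

Lemma diskew_xyE : x * y = iD rho * y * x + iD b.
Proof.
apply/eqP; rewrite addrC -subr_eq; apply/eqP.
have -> : x * y - iD rho * y * x =
    pres_class (diskew_rel sigma tau b rho)
      (Gen X * Gen Y - Coef rho * Gen Y * Gen X)%rterm.
  by rewrite !pres_classE.
exact/pres_classP/pres_rel/diskew_xy.
Qed.

Fixpoint xy_main (i : nat) : D :=
  if i is i'.+1 then rho * tau (xy_main i') else 1.

Fixpoint xy_rest (i : nat) : D :=
  if i is i'.+1 then rho * tau (xy_rest i') + b else 0.

Lemma xy_restS i : xy_rest i.+1 = rho * tau (xy_rest i) + b.
Proof. by []. Qed.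

(** Moving x to the right past y^i.  For [i = 0] the second term carries the
    coefficient 0, so the truncated exponent [i.-1] is harmless. *)
Lemma diskew_xyX i :
  x * y ^+ i = iD (xy_main i) * y ^+ i * x + iD (xy_rest i) * y ^+ i.-1.
Proof.
elim: i => [|i IHi].
  by rewrite !expr0 /= !rmorph0 rmorph1 !mulr1 !mul1r addr0.
rewrite exprS mulrA diskew_xyE mulrDl -[_ * x * _]mulrA IHi mulrDr -addrA.
congr (_ + _).
  by rewrite /= rmorphM !mulrA -[_ * y * iD _]mulrA diskew_ydE !mulrA.
rewrite /= rmorphD mulrDl; congr (_ + _).
rewrite !mulrA -[_ * y * iD _]mulrA diskew_ydE rmorphM !mulrA.
case: i {IHi} => [|i] /=; first by rewrite rmorph0 !mulr0 !mul0r.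
by rewrite -[_ * y * _]mulrA -exprS.
Qed.

(** The left D-span of the monomials is stable under left multiplication by
    the generators, hence by E; as it contains 1, it is everything. *)
Lemma diskew_ind (P : E -> Prop) :
    P 0 -> (forall s t, P s -> P t -> P (s + t)) ->
    (forall d i j, P (iD d * y ^+ i * x ^+ j)) ->
  forall s, P s.
Proof.
pose closed (P : E -> Prop) := [/\ P 0, forall s t, P s -> P t -> P (s + t)
  & forall d i j, P (iD d * y ^+ i * x ^+ j)].
(* The smallest additively closed set that contains the monomials. *)
pose span s := forall P, closed P -> P s.
move=> P0 PD Pm s; suff: span s by apply; split.
have span1 : span 1.
  move=> Q [_ _ Qm]; have := Qm 1 0 0.
  by rewrite rmorph1 !mulr1.
have spanN t : span t -> span (- t).
  move=> spt Q [Q0 QD Qm]; apply: (spt (fun u => Q (- u))); split=> //.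
  - by rewrite oppr0.
  - by move=> u v Qu Qv; rewrite opprD; exact: QD.
  - by move=> d i j; rewrite -!mulNr -rmorphN.
suff spanM t : span t -> span (s * t) by rewrite -[s]mulr1; exact: spanM.
elim/pres_ind: s t => [d|l|s1 s2 IH1 IH2|s IH|s1 s2 IH1 IH2] t spt.
- move=> Q [Q0 QD Qm]; apply: (spt (fun u => Q (iD d * u))); split=> //.
  + by rewrite mulr0.
  + by move=> u v Qu Qv; rewrite mulrDr; exact: QD.
  + by move=> d' i j; rewrite !mulrA -rmorphM.
- case: l => Q [Q0 QD Qm]; apply: (spt (fun u => Q (pres_gen _ _ * u))); split.
  + by rewrite mulr0.
  + by move=> u v Qu Qv; rewrite mulrDr; exact: QD.
  + move=> d i j; rewrite !mulrA diskew_xdE -[_ * x * _]mulrA diskew_xyX.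
    rewrite mulrDr mulrDl; apply: QD; rewrite !mulrA -rmorphM //.
    by rewrite -[_ * x * _]mulrA -exprS.
  + by rewrite mulr0.
  + by move=> u v Qu Qv; rewrite mulrDr; exact: QD.
  + by move=> d i j; rewrite !mulrA diskew_ydE -[_ * y * _]mulrA -exprS.
- move=> Q clQ; rewrite mulrDl; have [_ QD _] := clQ.
  by apply: QD; [apply: IH1 | apply: IH2].
- by rewrite mulNr; apply: spanN; apply: IH.
- by rewrite -mulrA; apply: IH1; apply: IH2.
Qed.

(** The families [f : nat -> nat -> D] stand for formal, possibly infinite,
    sums of the [f i j] y^i x^j.  The operators below are what left
    multiplication by [d], x and y does to such a sum once each monomial is put
    back in normal form; every value depends on finitely many entries of [f]. *)
Definition d_act (d : D) (f : nat -> nat -> D) : nat -> nat -> D :=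
  fun i j => d * f i j.

Definition x_act (f : nat -> nat -> D) : nat -> nat -> D := fun i j =>
  (if j is j'.+1 then sigma (f i j') * xy_main i else 0)
  + sigma (f i.+1 j) * xy_rest i.+1.

Definition y_act (f : nat -> nat -> D) : nat -> nat -> D := fun i j =>
  if i is i'.+1 then tau (f i' j) else 0.

Definition letter_act (l : xy_letter) := if l is X then x_act else y_act.

Definition delta (d : D) (i j : nat) : nat -> nat -> D :=
  fun k l => if (k == i) && (l == j) then d else 0.

Definition diskew_act : E -> (nat -> nat -> D) -> nat -> nat -> D :=
  pres_act d_act letter_act.

Lemma d_actDr d : {morph d_act d : f g / f + g}.
Proof. by move=> f g; apply/funext=> i; apply/funext=> j; exact: mulrDr. Qed.

Lemma d_actDl d d' f : d_act (d + d') f = d_act d f + d_act d' f.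
Proof. by apply/funext=> i; apply/funext=> j; exact: mulrDl. Qed.

Lemma d_actM d d' f : d_act (d * d') f = d_act d (d_act d' f).
Proof. by apply/funext=> i; apply/funext=> j; rewrite /d_act mulrA. Qed.

Lemma d_act1 f : d_act 1 f = f.
Proof. by apply/funext=> i; apply/funext=> j; exact: mul1r. Qed.

Lemma letter_actD l : {morph letter_act l : f g / f + g}.
Proof.
move=> f g; apply/funext=> i; apply/funext=> j; case: l => /=.
  rewrite /x_act -[RHS]/((_ + _) + (_ + _)) addrACA; congr (_ + _); last first.
    by rewrite -mulrDl -rmorphD.
  by case: j => [|j]; rewrite ?addr0 // -mulrDl -rmorphD.
rewrite /y_act -[RHS]/(_ + _); case: i => [|i]; first by rewrite addr0.
by rewrite -rmorphD.
Qed.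

(** The relation xy - rho yx = b holds at the coefficient of y^i x^j because
    rho can be moved past [tau (sigma _)] and [sigma (tau d) * b = b * d]; the
    recursions defining [xy_main] and [xy_rest] make the other terms cancel. *)
Lemma diskew_act_rel u v : diskew_rel sigma tau b rho u v ->
  term_act d_act letter_act u =1 term_act d_act letter_act v.
Proof.
have [hrho hb] := hE.
have push d t : rho * tau (sigma d * t) = sigma (tau d) * (rho * tau t).
  by rewrite rmorphM !mulrA hrho.
move=> [d|d|] f; apply/funext=> i; apply/funext=> j /=.
- rewrite /x_act /d_act [RHS]mulrDr [sigma (d * f i.+1 j)]rmorphM -mulrA.
  by congr (_ + _); case: j => [|j]; rewrite ?mulr0 // rmorphM mulrA.
- by rewrite /y_act /d_act; case: i => [|i]; rewrite ?mulr0 // rmorphM.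
- rewrite -[LHS]/(x_act (y_act f) i j - d_act rho (y_act (x_act f)) i j).
  rewrite /x_act /d_act /y_act [xy_rest i.+1]xy_restS.
  case: i => [|i] /=.
    rewrite !rmorph0 !mulr0 add0r subr0 hb.
    by case: j => [|j]; rewrite ?mul0r add0r.
  rewrite -!xy_restS [tau (_ + _)]rmorphD [rho * (_ + _)]mulrDr push mulrDr hb.
  case: j => [|j]; first by rewrite rmorph0 mulr0 !add0r addrC addKr.
  by rewrite push addrA [X in X - _]addrC addrK.
Qed.

Definition diskew_monomial (d : D) (i j : nat) : E := iD d * y ^+ i * x ^+ j.

(** The image of the normal form 1 under [s] is the normal form of [s]. *)
Definition coef (s : E) : nat -> nat -> D := diskew_act s (delta 1 0 0).

Let actM s t f : diskew_act (s * t) f = diskew_act s (diskew_act t f).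
Proof.
exact: (pres_actM d_actDr d_actDl d_actM d_act1 letter_actD diskew_act_rel).
Qed.

Let act_coef d f : diskew_act (iD d) f = d_act d f.
Proof.
exact: (pres_act_coef d_actDr d_actDl d_actM d_act1 letter_actD diskew_act_rel).
Qed.

Let act_gen l f : diskew_act (pres_gen _ l) f = letter_act l f.
Proof.
exact: (pres_act_gen d_actDr d_actDl d_actM d_act1 letter_actD diskew_act_rel).
Qed.

Lemma coefD s t i j : coef (s + t) i j = coef s i j + coef t i j.
Proof.
rewrite /coef /diskew_act.
by rewrite (pres_actDl d_actDr d_actDl d_actM d_act1 letter_actD diskew_act_rel).
Qed.

Lemma coef0 i j : coef 0 i j = 0.
Proof. by apply: (addrI (coef 0 i j)); rewrite -coefD !addr0. Qed.

Lemma coef_sum (J : Type) (r : seq J) (P : pred J) (F : J -> E) i j :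
  coef (\sum_(k <- r | P k) F k) i j = \sum_(k <- r | P k) coef (F k) i j.
Proof.
apply: (big_morph (fun s => coef s i j)) => [s t|]; [exact: coefD | exact: coef0].
Qed.

Lemma coef_monomial d i j k l :
  coef (diskew_monomial d i j) k l = if (k == i) && (l == j) then d else 0.
Proof.
have xm m : x_act (delta 1 0 m) = delta 1 0 m.+1.
  apply/funext=> p; apply/funext=> q; rewrite /x_act /delta /=.
  rewrite rmorph0 mul0r addr0; case: q => [|q]; first by rewrite andbF.
  rewrite eqSS; case: p => [|p] /=; last by rewrite rmorph0 mul0r.
  by rewrite mulr1; case: (q == m); rewrite ?rmorph0 ?rmorph1.
have ym m n : y_act (delta 1 m n) = delta 1 m.+1 n.
  apply/funext=> p; apply/funext=> q; rewrite /y_act /delta; case: p => [|p] //=.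
  by rewrite eqSS; case: (_ && _); rewrite ?rmorph0 ?rmorph1.
have xX m : diskew_act (x ^+ m) (delta 1 0 0) = delta 1 0 m.
  elim: m => [|m IHm]; last by rewrite exprS actM IHm act_gen /= xm.
  by rewrite expr0 -(rmorph1 iD) act_coef d_act1.
have yX m n : diskew_act (y ^+ m) (delta 1 0 n) = delta 1 m n.
  elim: m => [|m IHm]; last by rewrite exprS actM IHm act_gen /= ym.
  by rewrite expr0 -(rmorph1 iD) act_coef d_act1.
rewrite /coef /diskew_monomial !actM xX yX act_coef /d_act /delta.
by case: ifP; rewrite ?mulr1 ?mulr0.
Qed.

Lemma coef_iD d i j : coef (iD d) i j = if (i == 0) && (j == 0) then d else 0.
Proof. by rewrite -coef_monomial /diskew_monomial !mulr1. Qed.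

(** The bound on the indices is left free above [n0] so that the expansions of
    two elements can be brought to a common size and added. *)
Lemma diskew_expand s : exists n0, forall n, (n0 <= n)%N ->
  s = \sum_(i < n) \sum_(j < n) diskew_monomial (coef s i j) i j.
Proof.
have mD d d' i j : diskew_monomial (d + d') i j =
    diskew_monomial d i j + diskew_monomial d' i j.
  by rewrite /diskew_monomial rmorphD !mulrDl.
have m0 i j : diskew_monomial 0 i j = 0.
  by rewrite /diskew_monomial rmorph0 !mul0r.
elim/diskew_ind: s => [|s t [n1 IH1] [n2 IH2]|d i j].
- exists 0%N => n _; rewrite big1 // => i _; rewrite big1 // => j _.
  by rewrite coef0 m0.
- exists (maxn n1 n2) => n; rewrite geq_max => /andP[/IH1 e1 /IH2 e2].
  rewrite {1}e1 {1}e2 -big_split; apply: eq_bigr => i _.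
  by rewrite -big_split; apply: eq_bigr => j _; rewrite coefD mD.
- exists (maxn i j).+1 => n; rewrite gtn_max => /andP[lin ljn].
  rewrite (bigD1 (Ordinal lin)) //= (bigD1 (Ordinal ljn)) //=.
  rewrite coef_monomial !eqxx /= !big1 ?addr0 //.
    move=> k ki; rewrite big1 // => l _; rewrite coef_monomial.
    by rewrite -[k == i :> nat]/(k == Ordinal lin) (negPf ki) m0.
  move=> l lj; rewrite coef_monomial eqxx.
  by rewrite -[l == j :> nat]/(l == Ordinal ljn) (negPf lj) m0.
Qed.

Lemma coef_inj0 s : (forall i j, coef s i j = 0) -> s = 0.
Proof.
move=> s0; have [n /(_ n (leqnn n)) ->] := diskew_expand s.
rewrite big1 // => i _; rewrite big1 // => j _.
by rewrite s0 /diskew_monomial rmorph0 !mul0r.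
Qed.

Lemma coef_finite s : exists n, forall i j, (n <= i)%N -> coef s i j = 0.
Proof.
have [n /(_ n (leqnn n)) es] := diskew_expand s; exists n => i j le_ni.
rewrite es coef_sum big1 // => k _; rewrite coef_sum big1 // => l _.
by rewrite coef_monomial gtn_eqF // (leq_trans (ltn_ord k)).
Qed.
(** * The element C = yx + alpha *)

Variables (rhoV alpha : D).
Hypotheses (rhoVr : rho * rhoV = 1) (rhoVl : rhoV * rho = 1).

Local Notation C := (y * x + iD alpha).

(** Only the leading coefficient [w] matters later: it is a product of images of
    rho, hence a unit, whatever [alpha] is. *)
Lemma xX_mulC j :
  exists w z, invertible w /\
    x ^+ j * C = iD w * y * x ^+ j.+1 + iD z * x ^+ j.
Proof.
elim: j => [|j [w [z [winv IHj]]]].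
  by exists 1, alpha; split; [exact: invertible1 | rewrite mul1r rmorph1 mul1r mulr1].
exists (sigma w * rho), (sigma w * b + sigma z); split.
  by apply: invertibleM; [exact: invertible_morph | exists rhoV].
rewrite [x ^+ j.+2]exprS; move: (x ^+ j.+1) (exprS x j) IHj => p ep IHj.
rewrite {1}ep -mulrA IHj mulrDr !mulrA !diskew_xdE -[_ * x * y]mulrA diskew_xyE.
rewrite mulrDr mulrDl rmorphD !rmorphM mulrDl -!addrA; congr (_ + _).
  by rewrite !mulrA.
by rewrite ep !mulrA.
Qed.

Lemma monomial_mulC : exists u v : nat -> nat -> D,
  (forall i j, invertible (u i j)) /\
  forall d i j, diskew_monomial d i j * C =
    diskew_monomial (d * u i j) i.+1 j.+1 + diskew_monomial (d * v i j) i j.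
Proof.
have /choice [w /choice [z wz]] := xX_mulC.
exists (fun i j => iter i tau (w j)), (fun i j => iter i tau (z j)); split.
  move=> i j; elim: i => [|i IHi] /=; first by have [] := wz j.
  exact: invertible_morph.
move=> d i j; have [_ e] := wz j; rewrite /diskew_monomial -mulrA e mulrDr !mulrA.
rewrite -![iD d * _ * iD _]mulrA !diskew_yXdE !rmorphM !mulrA; congr (_ + _).
by rewrite [y ^+ i.+1]exprSr; move: (x ^+ j.+1) => p; rewrite !mulrA.
Qed.

Lemma coef_mulC : exists u v : nat -> nat -> D,
  (forall i j, invertible (u i j)) /\
  forall s i j, coef (s * C) i.+1 j.+1 =
    coef s i j * u i j + coef s i.+1 j.+1 * v i j.
Proof.
have [u [v [uinv mC]]] := monomial_mulC.
exists u, (fun i j => v i.+1 j.+1); split=> // s i j.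
elim/diskew_ind: s => [|s t IHs IHt|d k l].
- by rewrite mul0r !coef0 !mul0r addr0.
- by rewrite mulrDl !coefD IHs IHt !mulrDl addrACA.
- rewrite -/(diskew_monomial d k l) mC coefD !coef_monomial !eqSS.
  congr (_ + _); first by case: ifP => [/andP[/eqP-> /eqP->]|]; rewrite ?mul0r.
  by case: ifP => [/andP[/eqP-> /eqP->]|]; rewrite ?mul0r.
Qed.

(** The vanishing of the coefficient of s C at (i+1, j+1) expresses the
    coefficient of [s] at (i, j), up to a unit, through the one at (i+1, j+1).
    Since [s] has finitely many nonzero coefficients, induction on the distance
    to the end of the diagonal kills them all. *)
Lemma mulC_diag0 s : (forall i j, coef (s * C) i.+1 j.+1 = 0) -> s = 0.
Proof.
have [u [v [uinv sC]]] := coef_mulC; move=> sC0; apply: coef_inj0.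
have [n s0] := coef_finite s.
suff vanish m i j : (n <= i + m)%N -> coef s i j = 0.
  by move=> i j; apply: (vanish n); rewrite leq_addl.
elim: m i j => [|m IHm] i j lenim; first by apply: s0; rewrite -[i]addn0.
have := sC s i j; rewrite sC0 (IHm i.+1 j.+1) ?addSnnS // => /esym.
rewrite mul0r addr0 => su0.
by have [u' [uu' _]] := uinv i j; rewrite -[LHS]mulr1 -uu' mulrA su0 mul0r.
Qed.

Lemma C_left_regular : left_regular C.
Proof. by move=> s sC0; apply: mulC_diag0 => i j; rewrite sC0 coef0. Qed.

Lemma C_coef d : C * iD d = iD (tau (sigma d)) * y * x + iD (alpha * d).
Proof.
by rewrite mulrDl -mulrA diskew_xdE !mulrA diskew_ydE -rmorphM.
Qed.

Lemma x_C : x * C = (iD rho * y * x + iD (b + sigma alpha)) * x.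
Proof.
by rewrite mulrDr mulrA diskew_xyE diskew_xdE -mulrDl -addrA -rmorphD.
Qed.

Lemma y_C : y * C = y * y * x + iD (tau alpha) * y.
Proof. by rewrite mulrDr diskew_ydE mulrA. Qed.

Lemma C_y : C * y = iD (tau rho) * (y * y * x) + iD (tau b + alpha) * y.
Proof.
rewrite mulrDl -mulrA diskew_xyE mulrDr diskew_ydE -addrA -mulrDl -rmorphD.
by rewrite !mulrA diskew_ydE.
Qed.

(** Comparing C t with its expected value r C for the generators t = d, x, y
    isolates one coefficient each time, which must be 0. *)
Lemma left_normal_C_cond : left_normal C ->
  [/\ rho * alpha - sigma alpha = b, tau (sigma alpha) = alpha
    & forall d, alpha * d = tau (sigma d) * alpha].
Proof.
move=> nC.
(* The difference C t - r C is a left multiple of C supported on a monomial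
   y^i or x^j, so it is zero by mulC_diag0. *)
have gap t r d i j : (i == 0)%N || (j == 0)%N ->
    C * t - r * C = diskew_monomial d i j -> d = 0.
  move=> ij0 e; have [s' es'] := nC t.
  have {}e : (s' - r) * C = diskew_monomial d i j by rewrite mulrBl -es' e.
  have s'r : s' - r = 0.
    apply: mulC_diag0 => k l; rewrite e coef_monomial.
    by case: i j ij0 {e} => [|i] [|j]; rewrite ?andbF.
  by have := coef_monomial d i j i j; rewrite -e s'r mul0r coef0 !eqxx.
have Cd d : alpha * d = tau (sigma d) * alpha.
  apply/subr0_eq/(gap (iD d) (iD (tau (sigma d))) _ 0 0) => //.
  by rewrite C_coef mulrDr !mulrA -rmorphM opprD addrACA subrr add0r -rmorphB
    /diskew_monomial !mulr1.
have xe : alpha - rhoV * (b + sigma alpha) = 0.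
  apply: (gap x (iD rhoV * x) _ 0 1) => //.
  rewrite -[_ * x * C]mulrA x_C mulrA mulrDr !mulrA -!rmorphM rhoVl rmorph1 mul1r.
  by rewrite -mulrBl opprD addrACA subrr add0r -rmorphB /diskew_monomial mulr1.
have eb : rho * alpha - sigma alpha = b.
  by rewrite {1}(subr0_eq xe) mulrA rhoVr mul1r addrK.
have ye : (tau b + alpha) - tau rho * tau alpha = 0.
  apply: (gap y (iD (tau rho) * y) _ 1 0) => //.
  rewrite -[_ * y * C]mulrA y_C C_y mulrDr opprD addrACA subrr add0r mulrA.
  by rewrite -rmorphM -mulrBl -rmorphB /diskew_monomial mulr1.
split=> //.
apply/eqP; rewrite eq_sym -subr_eq0 -[X in _ == X]ye -eb rmorphB rmorphM.
by rewrite addrAC [X in _ == X + _]addrAC subrr add0r addrC.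
Qed.

Section NormalCondition.
Hypotheses (eq_b : rho * alpha - sigma alpha = b)
           (nu_alpha : tau (sigma alpha) = alpha)
           (alphaM : forall d, alpha * d = tau (sigma d) * alpha).

Let eq_rho_alpha : b + sigma alpha = rho * alpha.
Proof. by rewrite -eq_b subrK. Qed.

Let eq_tau_b : tau b + alpha = tau rho * tau alpha.
Proof. by rewrite -eq_b rmorphB nu_alpha subrK rmorphM. Qed.

(** The twisted commutation of [alpha] is inherited by [sigma alpha], which is
    [rho * alpha - b], through the axioms on rho and b. *)
Lemma sigma_alphaM d : sigma alpha * d = sigma (tau d) * sigma alpha.
Proof.
have [hrho hb] := hE.
have -> : sigma alpha = rho * alpha - b by rewrite -eq_b opprB addrC subrK.
by rewrite mulrBl mulrBr -mulrA alphaM !mulrA hrho hb.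
Qed.

Lemma C_comm_coef d : C * iD d = iD (tau (sigma d)) * C.
Proof. by rewrite C_coef alphaM mulrDr mulrA rmorphM. Qed.

Lemma x_C_comm : x * C = iD rho * C * x.
Proof. by rewrite x_C eq_rho_alpha mulrDr rmorphM !mulrA. Qed.

Lemma C_x_comm : C * x = iD rhoV * x * C.
Proof. by rewrite -mulrA x_C_comm !mulrA -rmorphM rhoVl rmorph1 mul1r. Qed.

Lemma C_y_comm : C * y = iD (tau rho) * y * C.
Proof.
rewrite C_y eq_tau_b -[_ * y * C]mulrA y_C mulrDr.
by rewrite [iD (tau rho * _)]rmorphM !mulrA.
Qed.

Lemma y_C_comm : y * C = iD (tau rhoV) * C * y.
Proof. by rewrite -mulrA C_y_comm !mulrA -!rmorphM rhoVl !rmorph1 mul1r. Qed.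

Lemma CE : C = iD rhoV * (x * y + iD (sigma alpha)).
Proof.
rewrite diskew_xyE -addrA -rmorphD eq_rho_alpha rmorphM -mulrA -mulrDr mulrA.
by rewrite -rmorphM rhoVl rmorph1 mul1r.
Qed.

Lemma h_C_comm : ring_comm (y * x) C = 0.
Proof.
rewrite /ring_comm mulrDl mulrDr opprD addrACA subrr add0r.
by rewrite -mulrA diskew_xdE mulrA diskew_ydE nu_alpha mulrA subrr.
Qed.

(** The unit [k] collects the factors [tau rho] and [rhoV] produced when C
    passes each y and each x. *)
Lemma C_swap_monomial i j : exists k, invertible k /\ forall d,
  C * diskew_monomial d i j = diskew_monomial (tau (sigma d) * k) i j * C.
Proof.
have [k [kinv kE]] : exists k, invertible k /\ C * y ^+ i = iD k * y ^+ i * C.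
  elim: i => [|i [k [kinv kE]]].
    by exists 1; split; [exact: invertible1 | rewrite rmorph1 !mulr1 mul1r].
  exists (tau rho * tau k); split.
    rewrite -rmorphM; apply/invertible_morph/invertibleM => //.
    by exists rhoV.
  rewrite exprS mulrA C_y_comm -[_ * y * C * _]mulrA kE !mulrA.
  by rewrite -[_ * y * iD k]mulrA diskew_ydE rmorphM !mulrA.
have [l [linv lE]] : exists l, invertible l /\ C * x ^+ j = iD l * x ^+ j * C.
  elim: j => [|j [l [linv lE]]].
    by exists 1; split; [exact: invertible1 | rewrite rmorph1 !mulr1 mul1r].
  exists (rhoV * sigma l); split.
    by apply: invertibleM; [exists rho | exact: invertible_morph].
  rewrite exprS mulrA C_x_comm -[_ * x * C * _]mulrA lE !mulrA.
  by rewrite -[_ * x * iD l]mulrA diskew_xdE rmorphM !mulrA.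
exists (k * iter i tau l); split.
  apply: invertibleM => //; elim: i {kE} => [|i IHi] //=.
  exact: invertible_morph.
move=> d; rewrite /diskew_monomial !mulrA C_comm_coef -[_ * C * _]mulrA kE.
rewrite !mulrA -[_ * C * x ^+ j]mulrA lE !mulrA.
by rewrite -[_ * _ * iD l]mulrA diskew_yXdE !rmorphM !mulrA.
Qed.

(** Left multiplication by C equals right multiplication by C after the
    coefficientwise transformation of [s] by nu and by units: this is what
    turns properties of C on the other side into properties of nu. *)
Lemma C_swap : exists k : nat -> nat -> D, (forall i j, invertible (k i j)) /\
  forall s, exists s', C * s = s' * C /\
    forall i j, coef s' i j = tau (sigma (coef s i j)) * k i j.
Proof.
have /choice [k kP] : forall ij : nat * nat, exists k, invertible k /\ forall d,
    C * diskew_monomial d ij.1 ij.2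
    = diskew_monomial (tau (sigma d) * k) ij.1 ij.2 * C.
  by move=> [i j]; exact: C_swap_monomial.
exists (fun i j => k (i, j)); split=> [i j|]; first by have [] := kP (i, j).
elim/diskew_ind => [|s t [s' [es cs]] [t' [et ct]]|d i j].
- exists 0; split; first by rewrite mulr0 mul0r.
  by move=> i j; rewrite !coef0 !rmorph0 mul0r.
- exists (s' + t'); split; first by rewrite mulrDr es et mulrDl.
  by move=> i j; rewrite !coefD cs ct !rmorphD mulrDl.
- exists (diskew_monomial (tau (sigma d) * k (i, j)) i j).
  split=> [|i' j']; first by have [_ ->] := kP (i, j).
  rewrite !coef_monomial; case: ifP => [/andP[/eqP-> /eqP->] //|_].
  by rewrite !rmorph0 mul0r.
Qed.

Lemma C_left_normal : left_normal C.
Proof. by have [k [_ kP]] := C_swap; move=> s; have [s' [e _]] := kP s; exists s'. Qed.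

(** If [d * k 0 0] times C lies in C E, then it is C s for some s, and left
    regularity identifies the constant coefficient: [d * k 0 0] is
    [nu (coef s 0 0) * k 0 0].  Conversely, surjectivity of nu lets each
    monomial cross C in the other direction. *)
Lemma C_normalP : normal_elt C <-> forall d, exists d', tau (sigma d') = d.
Proof.
split=> [[_ nC] d|nu_surj].
  have [k [kinv kP]] := C_swap.
  have [s es] := nC (iD (d * k 0 0)).
  have [s' [es' cs']] := kP s.
  have {}es' : iD (d * k 0 0) = s'.
    apply/subr0_eq/C_left_regular.
    by rewrite mulrBl es es' subrr.
  exists (coef s 0 0); have [k' [kk' _]] := kinv 0 0.
  rewrite -[LHS]mulr1 -kk' mulrA -cs' -es' coef_iD /=.
  by rewrite -mulrA kk' mulr1.
split=> [|s]; first exact: C_left_normal.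
elim/diskew_ind: s => [|s t [s' es] [t' et]|d i j].
- by exists 0; rewrite mulr0 mul0r.
- by exists (s' + t'); rewrite [LHS]mulrDl [RHS]mulrDr es et.
- have [k [[k' [kk' k'k]] kP]] := C_swap_monomial i j.
  have [d' ed'] := nu_surj (d * k').
  exists (diskew_monomial d' i j).
  by rewrite kP ed' -[d * k' * k]mulrA k'k mulr1.
Qed.

Lemma C_right_regularP : right_regular C <-> forall d, tau (sigma d) = 0 -> d = 0.
Proof.
split=> [rC d nd0|nu_inj s sC0].
  have : iD d = 0 by apply: rC; rewrite C_comm_coef nd0 rmorph0 mul0r.
  by have := coef_iD d 0 0 => /= + d0; rewrite d0 coef0.
have [k [kinv kP]] := C_swap.
have [s' [es cs']] := kP s.
have s'0 : s' = 0 by apply: C_left_regular; rewrite -es.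
apply: coef_inj0 => i j; apply: nu_inj.
have [k' [kk' _]] := kinv i j.
by rewrite -[LHS]mulr1 -kk' mulrA -cs' s'0 coef0 mul0r.
Qed.

End NormalCondition.

End DiskewBasis.

(** * Universal properties *)

Section SkewPolyTheory.
Variables (D : pzRingType) (nu : {rmorphism D -> D}).

Lemma skew_varM d : skew_var nu * skew_coef nu d = skew_coef nu (nu d) * skew_var nu.
Proof.
by rewrite -[LHS]pres_classM -[RHS]pres_classM; apply/pres_classP/pres_rel/skew_hd.
Qed.

Lemma skew_lift (S : pzRingType) (g : {rmorphism D -> S}) (t : S) :
    (forall d, t * g d = g (nu d) * t) ->
  exists f : {rmorphism skew_poly nu -> S},
    (forall d, f (skew_coef nu d) = g d) /\ f (skew_var nu) = t.
Proof.
move=> tg; have [|f [fc fg]] := @pres_lift _ _ (skew_rel nu) S g (fun=> t).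
  by move=> u w [d] /=.
by exists f; split=> //; exact: fg.
Qed.

Lemma skew_ind (P : skew_poly nu -> Prop) :
    (forall d, P (skew_coef nu d)) -> P (skew_var nu) ->
    (forall s t, P s -> P t -> P (s + t)) -> (forall s, P s -> P (- s)) ->
    (forall s t, P s -> P t -> P (s * t)) ->
  forall s, P s.
Proof. by move=> Pc Pt; apply: pres_ind => // -[]. Qed.

Lemma skew_morph_ext (S : pzRingType) (f g : {rmorphism skew_poly nu -> S}) :
    (forall d, f (skew_coef nu d) = g (skew_coef nu d)) ->
    f (skew_var nu) = g (skew_var nu) ->
  f =1 g.
Proof. by move=> fgc fgt; apply: pres_morph_ext => // -[]. Qed.

(** The commutation rules of [gwa_axiom] need only be checked on generators. *)
Lemma skew_twisted (f : {rmorphism skew_poly nu -> skew_poly nu}) a :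
    (forall d, a * skew_coef nu d = f (skew_coef nu d) * a) ->
    a * skew_var nu = f (skew_var nu) * a ->
  forall r, a * r = f r * a.
Proof.
move=> ac at_; apply: skew_ind => // [s t es et|s es|s t es et].
- by rewrite mulrDr es et rmorphD mulrDl.
- by rewrite mulrN es rmorphN mulNr.
- by rewrite mulrA es -mulrA et mulrA rmorphM.
Qed.

End SkewPolyTheory.

Section DiskewTheory.
Variables (D : pzRingType) (sigma tau : {rmorphism D -> D}) (b rho : D).

Lemma diskew_lift (S : pzRingType) (g : {rmorphism D -> S}) (x y : S) :
    (forall d, x * g d = g (sigma d) * x) ->
    (forall d, y * g d = g (tau d) * y) ->
    x * y - g rho * y * x = g b ->
  exists f : {rmorphism diskew sigma tau b rho -> S},
    [/\ forall d, f (diskew_coef sigma tau b rho d) = g d,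
        f (diskew_x sigma tau b rho) = x & f (diskew_y sigma tau b rho) = y].
Proof.
move=> xg yg xy.
have [|f [fc fg]] := @pres_lift _ _ (diskew_rel sigma tau b rho) S g
  (fun l => if l is X then x else y).
  by move=> u w [d|d|] /=.
by exists f; split=> //; [exact: (fg X) | exact: (fg Y)].
Qed.

Lemma diskew_morph_ext (S : pzRingType)
    (f g : {rmorphism diskew sigma tau b rho -> S}) :
    (forall d, f (diskew_coef sigma tau b rho d)
               = g (diskew_coef sigma tau b rho d)) ->
    f (diskew_x sigma tau b rho) = g (diskew_x sigma tau b rho) ->
    f (diskew_y sigma tau b rho) = g (diskew_y sigma tau b rho) ->
  f =1 g.
Proof. by move=> fgc fgx fgy; apply: pres_morph_ext => // -[]. Qed.

End DiskewTheory.

Section GwaTheory.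
Variables (R : pzRingType) (sigma tau : {rmorphism R -> R}) (a : R).

Local Notation iR := (gwa_coef sigma tau a).
Local Notation x := (gwa_x sigma tau a).
Local Notation y := (gwa_y sigma tau a).

Lemma gwa_xrE r : x * iR r = iR (sigma r) * x.
Proof.
by rewrite -[LHS]pres_classM -[RHS]pres_classM; apply/pres_classP/pres_rel/gwa_xr.
Qed.

Lemma gwa_yrE r : y * iR r = iR (tau r) * y.
Proof.
by rewrite -[LHS]pres_classM -[RHS]pres_classM; apply/pres_classP/pres_rel/gwa_yr.
Qed.

Lemma gwa_yxE : y * x = iR a.
Proof. by rewrite -[LHS]pres_classM; apply/pres_classP/pres_rel/gwa_yx. Qed.

Lemma gwa_xyE : x * y = iR (sigma a).
Proof. by rewrite -[LHS]pres_classM; apply/pres_classP/pres_rel/gwa_xy. Qed.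

Lemma gwa_lift (S : pzRingType) (g : {rmorphism R -> S}) (x' y' : S) :
    (forall r, x' * g r = g (sigma r) * x') ->
    (forall r, y' * g r = g (tau r) * y') ->
    y' * x' = g a -> x' * y' = g (sigma a) ->
  exists f : {rmorphism gwa sigma tau a -> S},
    [/\ forall r, f (iR r) = g r, f x = x' & f y = y'].
Proof.
move=> xg yg yx xy.
have [|f [fc fg]] := @pres_lift _ _ (gwa_rel sigma tau a) S g
  (fun l => if l is X then x' else y').
  by move=> u w [r|r||] /=.
by exists f; split=> //; [exact: (fg X) | exact: (fg Y)].
Qed.

Lemma gwa_morph_ext (S : pzRingType) (f g : {rmorphism gwa sigma tau a -> S}) :
    (forall r, f (iR r) = g (iR r)) -> f x = g x -> f y = g y -> f =1 g.
Proof. by move=> fgc fgx fgy; apply: pres_morph_ext => // -[]. Qed.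

End GwaTheory.

Section QuotientTheory.
Variables (S T : pzRingType) (c : S).

Lemma quot_lift (f : {rmorphism S -> T}) : f c = 0 ->
  exists g : {rmorphism quot_ring c -> T}, forall s, g (quot_proj c s) = f s.
Proof.
move=> fc; pose g (p : quot_ring c) := f (repr p).
have gE s : g (quot_proj c s) = f s.
  apply/subr0_eq; rewrite -rmorphB; have [e ->] := repr_proj c s.
  by rewrite rmorph_sum big1 // => p _; rewrite !rmorphM fc mulr0 mul0r.
have gB : zmod_morphism g.
  move=> p q; have [s ->] := quot_proj_surj p; have [t ->] := quot_proj_surj q.
  by rewrite -rmorphB !gE rmorphB.
have gM : monoid_morphism g.
  split=> [|p q]; first by rewrite -(rmorph1 (quot_proj c)) gE rmorph1.
  have [s ->] := quot_proj_surj p; have [t ->] := quot_proj_surj q.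
  by rewrite -rmorphM !gE rmorphM.
pose gz := GRing.isZmodMorphism.Build _ _ g gB.
pose gm := GRing.isMonoidMorphism.Build _ _ g gM.
pose G : {rmorphism quot_ring c -> T} := HB.pack g gz gm.
by exists G.
Qed.

Lemma quot_proj_gen : quot_proj c c = 0.
Proof.
rewrite -[RHS](rmorph0 (quot_proj c)); apply/quot_projP; rewrite subr0.
by exists [:: (1, 1)]; rewrite big_seq1 mul1r mulr1.
Qed.

End QuotientTheory.

(** * The generalized Weyl algebra presentations *)

Section Presentations.
Variables (D : pzRingType) (sigma tau : {rmorphism D -> D}) (b rho rhoV : D).
Variable alpha : D.
Hypotheses (hE : diskew_axiom sigma tau b rho)
           (rhoVr : rho * rhoV = 1) (rhoVl : rhoV * rho = 1)
           (eq_b : rho * alpha - sigma alpha = b)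
           (nu_alpha : tau (sigma alpha) = alpha)
           (alphaM : forall d, alpha * d = tau (sigma d) * alpha).

Local Notation E := (diskew sigma tau b rho).
Local Notation iD := (diskew_coef sigma tau b rho).
Local Notation x := (diskew_x sigma tau b rho).
Local Notation y := (diskew_y sigma tau b rho).
Local Notation C := (y * x + iD alpha).

Let sigmaM := sigma_alphaM hE eq_b alphaM.

Lemma gwa_axiom_opp_alpha : gwa_axiom sigma tau (- alpha).
Proof.
split=> [|d|d].
- by rewrite !rmorphN nu_alpha.
- by rewrite mulNr mulrN alphaM.
- by rewrite rmorphN mulNr mulrN sigmaM.
Qed.

(** Modulo C one has yx = - alpha, and then xy = rho yx + b becomes
    - sigma(alpha): these are the relations of the generalized Weyl algebra. *)
Lemma quot_C_iso : exists f : {rmorphism quot_ring C -> gwa sigma tau (- alpha)},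
  bijective f /\
  [/\ forall d, f (quot_proj C (iD d)) = gwa_coef sigma tau (- alpha) d,
      f (quot_proj C x) = gwa_x sigma tau (- alpha)
    & f (quot_proj C y) = gwa_y sigma tau (- alpha)].
Proof.
set G := gwa _ _ _; set iG := gwa_coef _ _ _; set X := gwa_x _ _ _.
set Y := gwa_y _ _ _.
have XYE : X * Y - iG rho * Y * X = iG b.
  rewrite -mulrA gwa_yxE gwa_xyE -rmorphM -rmorphB !rmorphN.
  by rewrite mulrN opprK addrC eq_b.
have [f [fd fx fy]] := diskew_lift (gwa_xrE _ _ _) (gwa_yrE _ _ _) XYE.
have fC : f C = 0 by rewrite rmorphD rmorphM fx fy fd gwa_yxE -rmorphD addNr rmorph0.
have [F FE] := quot_lift fC.
pose q : {rmorphism E -> quot_ring C} := quot_proj C.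
have qyx : q y * q x = q (iD (- alpha)).
  apply/subr0_eq; rewrite -rmorphM -rmorphB rmorphN opprK.
  exact: quot_proj_gen.
have qxy : q x * q y = q (iD (sigma (- alpha))).
  have eb : iD b = iD (rho * alpha - sigma alpha) by rewrite eq_b.
  rewrite -rmorphM diskew_xyE rmorphD -mulrA rmorphM [q (y * x)]rmorphM qyx eb.
  by rewrite -rmorphM -rmorphD -rmorphM -rmorphD mulrN addKr [sigma (- _)]rmorphN.
have [g [gd gx gy]] : exists g : {rmorphism G -> quot_ring C},
    [/\ forall d, g (iG d) = q (iD d), g X = q x & g Y = q y].
  apply: (gwa_lift (g := q \o iD)) => //= d; rewrite -!rmorphM.
    by rewrite diskew_xdE.
  by rewrite diskew_ydE.
exists F; split; last by split=> [d||]; rewrite FE.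
have gfE s : g (f s) = q s.
  apply: (@diskew_morph_ext _ _ _ _ _ _ (g \o f) q) => [d||] /=.
  - by rewrite fd gd.
  - by rewrite fx gx.
  - by rewrite fy gy.
exists g => [p|u]; first by have [s ->] := quot_proj_surj p; rewrite FE gfE.
apply: (@gwa_morph_ext _ _ _ _ _ (F \o g) idfun) => [d||] /=.
- by rewrite gd FE fd.
- by rewrite gx FE fx.
- by rewrite gy FE fy.
Qed.

Local Notation nu := (tau \o sigma : {rmorphism D -> D}).
Local Notation R := (skew_poly nu).
Local Notation iR := (skew_coef nu).
Local Notation t := (skew_var nu).
Local Notation a := (t - iR alpha).

Lemma rhoV_nu d : rhoV * sigma (tau d) = tau (sigma d) * rhoV.
Proof.
have [hrho _] := hE.
by rewrite -[LHS]mulr1 -rhoVr mulrA -[_ * _ * rho]mulrA hrho mulrA rhoVl mul1r.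
Qed.

Lemma sigma_tau_extend : exists sigmaC tauC : {rmorphism R -> R},
  [/\ forall d, sigmaC (iR d) = iR (sigma d), sigmaC t = iR rho * t,
      forall d, tauC (iR d) = iR (tau d) & tauC t = iR (tau rhoV) * t].
Proof.
have [hrho _] := hE.
have [|sC [sCd sCt]] := @skew_lift _ nu R (iR \o sigma) (iR rho * t).
  by move=> d /=; rewrite -mulrA skew_varM !mulrA -!rmorphM /= hrho.
have [|tC [tCd tCt]] := @skew_lift _ nu R (iR \o tau) (iR (tau rhoV) * t).
  by move=> d /=; rewrite -mulrA skew_varM !mulrA -!rmorphM /= rhoV_nu.
by exists sC, tC; split.
Qed.

Section Isomorphism.
Variables sigmaC tauC : {rmorphism R -> R}.
Hypotheses (sigmaCd : forall d, sigmaC (iR d) = iR (sigma d))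
           (sigmaCt : sigmaC t = iR rho * t)
           (tauCd : forall d, tauC (iR d) = iR (tau d))
           (tauCt : tauC t = iR (tau rhoV) * t).

Lemma sigmaC_a : sigmaC a = iR rho * t - iR (sigma alpha).
Proof. by rewrite rmorphB sigmaCd sigmaCt. Qed.

(** On coefficients this is the twisted commutation of [alpha] and
    [sigma alpha].  On the variable [t], the composite of [tauC] and [sigmaC]
    is trivial while the opposite one multiplies [t] by
    [rho * nu rhoV]; the last axiom then amounts to [sigma_nu_alpha]. *)
Lemma gwa_axiom_a : gwa_axiom sigmaC tauC a.
Proof.
have [hrho _] := hE.
have sigma_nu_alpha : rho * tau (sigma (rhoV * sigma alpha)) = sigma alpha.
  by rewrite -hrho !rmorphM nu_alpha -sigmaM -mulrA rhoVl mulr1.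
have tauCsigmaCt : tauC (sigmaC t) = t.
  by rewrite sigmaCt rmorphM tauCd tauCt mulrA -!rmorphM rhoVr !rmorph1 mul1r.
split.
- by rewrite rmorphB rmorphB tauCsigmaCt sigmaCd tauCd nu_alpha.
- apply: (@skew_twisted _ _ (tauC \o sigmaC)) => [d|] /=.
    rewrite sigmaCd tauCd mulrBl mulrBr skew_varM -!rmorphM /=.
    by rewrite alphaM.
  by rewrite tauCsigmaCt mulrBl mulrBr skew_varM /= nu_alpha.
- apply: (@skew_twisted _ _ (sigmaC \o tauC)) => [d|] /=; rewrite sigmaC_a.
    rewrite tauCd sigmaCd mulrBl mulrBr -mulrA skew_varM !mulrA -!rmorphM /=.
    by rewrite -hrho [sigma (_ * alpha)]rmorphM sigmaM.
  have -> : sigmaC (tauC t) = iR (rho * tau (sigma rhoV)) * t.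
    by rewrite tauCt rmorphM sigmaCd sigmaCt mulrA -rmorphM hrho.
  have -> : iR (rho * tau (sigma rhoV)) * t * (iR rho * t - iR (sigma alpha))
      = iR (rho * tau (sigma (rhoV * rho))) * t * t
        - iR (rho * tau (sigma (rhoV * sigma alpha))) * t.
    rewrite mulrBr -![iR _ * t * _]mulrA [t * (_ * _)]mulrA !skew_varM /=.
    by rewrite !rmorphM !mulrA.
  by rewrite sigma_nu_alpha rhoVl !rmorph1 mulr1 mulrBl.
Qed.

(** Since [h = C - alpha], adjoining [t = C] to D amounts to adjoining h; the
    relations yx = a and xy = sigma(a) of the generalized Weyl algebra say that
    h = yx and that xy = rho yx + b. *)
Lemma diskew_gwa_iso : exists f : {rmorphism E -> gwa sigmaC tauC a},
  bijective f /\
  [/\ forall d, f (iD d) = gwa_coef sigmaC tauC a (iR d),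
      f C = gwa_coef sigmaC tauC a t,
      f x = gwa_x sigmaC tauC a
    & f y = gwa_y sigmaC tauC a].
Proof.
set G := gwa _ _ _; set iG := gwa_coef _ _ _; set X := gwa_x _ _ _.
set Y := gwa_y _ _ _.
have [f [fd fx fy]] : exists f : {rmorphism E -> G},
    [/\ forall d, f (iD d) = iG (iR d), f x = X & f y = Y].
  apply: (diskew_lift (g := iG \o iR)) => [d|d|] /=.
  - by rewrite gwa_xrE sigmaCd.
  - by rewrite gwa_yrE tauCd.
  - have eb : sigmaC a - iR rho * a = iR b.
      rewrite sigmaC_a mulrBr opprB addrC addrA subrK.
      by rewrite -rmorphM -rmorphB eq_b.
    by rewrite -mulrA gwa_yxE gwa_xyE -rmorphM -rmorphB eb.
have fC : f C = iG t by rewrite rmorphD rmorphM fx fy fd gwa_yxE -rmorphD subrK.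
have Cd d : C * iD d = iD (nu d) * C by exact: C_comm_coef.
have [h [hd ht]] := skew_lift Cd.
have [g [gr gx gy]] : exists g : {rmorphism G -> E},
    [/\ forall r, g (iG r) = h r, g X = x & g Y = y].
  (* A commutation rule for z extends from the generators of R to R. *)
  have push z (s : {rmorphism R -> R}) : (forall d, z * iD d = h (s (iR d)) * z) ->
      z * C = h (s t) * z -> forall r, z * h r = h (s r) * z.
    move=> zd zC; apply: skew_ind => [d||u v eu ev|u eu|u v eu ev].
    - by rewrite hd zd.
    - by rewrite ht zC.
    - by rewrite !rmorphD mulrDl mulrDr eu ev.
    - by rewrite !rmorphN mulNr mulrN eu.
    - by rewrite !rmorphM mulrA eu -mulrA ev mulrA.
  apply: gwa_lift.
  - apply: push => [d|]; first by rewrite sigmaCd hd diskew_xdE.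
    by rewrite sigmaCt rmorphM hd ht; exact: x_C_comm.
  - apply: push => [d|]; first by rewrite tauCd hd diskew_ydE.
    by rewrite tauCt rmorphM hd ht; exact: y_C_comm.
  - by rewrite rmorphB ht hd addrK.
  - have eb : iD b = iD rho * iD alpha - iD (sigma alpha).
      by rewrite -rmorphM -rmorphB eq_b.
    by rewrite sigmaC_a rmorphB rmorphM !hd ht diskew_xyE eb mulrDr addrA mulrA.
exists f; split=> //; exists g => [s|u].
  apply: (@diskew_morph_ext _ _ _ _ _ _ (g \o f) idfun) => [d||] /=.
  - by rewrite fd gr hd.
  - by rewrite fx gx.
  - by rewrite fy gy.
apply: (@gwa_morph_ext _ _ _ _ _ (f \o g) idfun) => [r||] /=.
- rewrite gr; apply: (@skew_morph_ext _ _ _ (f \o h) iG) => [d|] /=.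
    by rewrite hd fd.
  by rewrite ht fC.
- by rewrite gx fx.
- by rewrite gy fy.
Qed.

End Isomorphism.
End Presentations.

(** * The characterization of left normality and its consequences *)

Theorem theorem1p6 (D : pzRingType) (sigma tau : {rmorphism D -> D})
    (b rho rhoV : D) (alpha : D)
    (hE : diskew_axiom sigma tau b rho)
    (rhoVr : rho * rhoV = 1) (rhoVl : rhoV * rho = 1) :
  let nu : {rmorphism D -> D} := tau \o sigma in
  let E := diskew sigma tau b rho in
  let iD := diskew_coef sigma tau b rho in
  let x := diskew_x sigma tau b rho in
  let y := diskew_y sigma tau b rho in
  let h := y * x in
  let C := h + iD alpha in
  let cond1 := left_normal C in
  let cond2 := [/\ rho * alpha - sigma alpha = b,
                   nu alpha = alpha
                 & forall d, alpha * d = nu d * alpha] in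
  (cond1 <-> cond2) /\
  (cond1 \/ cond2 ->
   ring_comm h C = 0 /\
   [/\ (* (a) *)
       [/\ C = iD rhoV * (x * y + iD (sigma alpha)),
           x * C = iD rho * C * x
         & y * C = iD (tau rhoV) * C * y],
       (* (b) *)
       (exists sigmaC tauC : {rmorphism skew_poly nu -> skew_poly nu},
          let iR := skew_coef nu in
          let t := skew_var nu in
          let a := t - iR alpha in
          [/\ (forall d, sigmaC (iR d) = iR (sigma d)) /\ sigmaC t = iR rho * t,
              (forall d, tauC (iR d) = iR (tau d)) /\
                tauC t = iR (tau rhoV) * t,
              gwa_axiom sigmaC tauC a
            & exists f : {rmorphism E -> gwa sigmaC tauC a},
                bijective f /\
                [/\ forall d, f (iD d) = gwa_coef sigmaC tauC a (iR d),
                    f C = gwa_coef sigmaC tauC a t,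
                    f x = gwa_x sigmaC tauC a
                  & f y = gwa_y sigmaC tauC a]]),
       (* (c) *)
       [/\ left_normal C, left_regular C, gwa_axiom sigma tau (- alpha)
         & exists f : {rmorphism quot_ring C -> gwa sigma tau (- alpha)},
             bijective f /\
             [/\ forall d, f (quot_proj C (iD d)) =
                           gwa_coef sigma tau (- alpha) d,
                 f (quot_proj C x) = gwa_x sigma tau (- alpha)
               & f (quot_proj C y) = gwa_y sigma tau (- alpha)]],
       (* (d) *)
       normal_elt C <-> range nu = [set: D]
     & (* (e) *)
       ((regular_elt C <-> right_regular C) /\
        (right_regular C <-> [set d | nu d = 0] = [set 0])) /\
       (* (f) *)
       (normal_elt C /\ regular_elt C <-> bijective nu)]).
Proof.
move=> nu E iD x y h C cond1 cond2.
have cond12 : cond1 -> cond2 by exact: (left_normal_C_cond hE rhoVr rhoVl).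
have cond21 : cond2 -> cond1 by move=> [eb na aM]; exact: (C_left_normal hE rhoVr rhoVl).
split; first by split.
move=> c12; have [eb na aM] : cond2 by case: c12 => // /cond12.
have lreg : left_regular C by move=> s; exact: (C_left_regular hE rhoVr rhoVl).
have normalP := C_normalP hE rhoVr rhoVl eb na aM.
have rregP := C_right_regularP hE rhoVr rhoVl eb na aM.
split; first exact: h_C_comm.
split.
- by split; [exact: CE | exact: x_C_comm | exact: y_C_comm].
- have [sC [tC [sCd sCt tCd tCt]]] := sigma_tau_extend hE rhoVr rhoVl.
  exists sC, tC; split; [by split | by split | |].
    exact: (gwa_axiom_a hE rhoVr).
  exact: (diskew_gwa_iso rhoVl eb na aM).
- split=> //; first by apply: cond21.
    exact: (gwa_axiom_opp_alpha hE eb).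
  exact: quot_C_iso.
- split=> [/normalP nsurj|nsurj].
    by apply/seteqP; split=> // d _; have [d' <-] := nsurj d; exists d'.
  apply/normalP => d; have : range nu d by rewrite nsurj.
  by move=> [d' _ <-]; exists d'.
- split.
    split; first by split=> [[]|].
    split=> [/rregP ninj|ninj].
      apply/seteqP; split=> d /=; first exact: ninj.
      by move=> ->; exact: (rmorph0 nu).
    by apply/rregP => d nd0; have : [set d | nu d = 0] d by []; rewrite ninj.
  split=> [[/normalP nsurj [_ /rregP ninj]]|[nuV nuK nuVK]].
    have /choice [nuV nuVK] := nsurj.
    exists nuV => // d; apply/subr0_eq/ninj.
    by rewrite !rmorphB nuVK subrr.
  split; first by apply/normalP => d; exists (nuV d); exact: nuVK.
  split=> //; apply/rregP => d nd0.
  by rewrite -(nuK d) -[RHS](nuK 0) [nu 0]rmorph0 -[nu d]/(tau (sigma d)) nd0.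
Qed.
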